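(* For a sequence $\{t_n\}_{n=0}^\infty\subset[0,1]$, the following are equivalent: (i) $\sum_n t_n^2=\infty$; (ii) for every real Hilbert space $H$, every family $\{C_\alpha\}_{\alpha\in\Omega}$ ($|\Omega|\ge 2$) of closed convex subsets of $H$ with nonempty intersection $C=\bigcap_\alpha C_\alpha$, and every starting element $x_0\in H$, every sequence $\{x_n\}$ of remote projections onto $\{C_\alpha\}$ with weakness parameters $\{t_n\}$ has a partial weak limit (weak limit of some subsequence) belonging to $C$; (iii) for every real Hilbert space $H$, every dictionary $D\subset S(H)$ and every starting element $x_0\in H$, the residuals $\{x_n\}$ of every realization of the Weak Greedy Algorithm with weakness parameters $\{t_n\}$ have $0$ as a partial weak limit.
   Context: $P_\alpha$ is the metric projection onto $C_\alpha$. A sequence of remote projections with weakness parameters $t_n\in[0,1]$ starting at $x_0$: $x_{n+1}=P_{\alpha(n)}x_n$, where $\alpha(n)\in\Omega$ is any index with $\mathrm{dist}(x_n,C_{\alpha(n)})\ge t_n\sup_\alpha\mathrm{dist}(x_n,C_\alpha)$; if $t_n=1$ for some $n$ it is required that $\max_\alpha\mathrm{dist}(x,C_\alpha)$ is attained for every $x\in H$. $S(H)=\{s\in H:|s|=1\}$; a dictionary is a set $D\subset S(H)$ whose closed linear span is $H$. The Weak Greedy Algorithm with weakness parameters $\{t_n\}$ and starting element $x_0$ generates $x_{n+1}=x_n-\langle x_n,g_n\rangle g_n$, where $g_n\in D$ is any element with $|\langle x_n,g_n\rangle|\ge t_n\sup\{|\langle x_n,g\rangle|:g\in D\}$; if $t_n=1$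 for some $n$ it is required that $\max\{|\langle x,g\rangle|:g\in D\}$ is attained for every $x\in H$. *)

(* Defs.v *)
From HB Require Import structures.
From mathcomp Require Import all_boot all_order all_algebra.
From mathcomp Require Import all_classical all_reals.
From mathcomp Require Import topology normedtype sequences.
From mathcomp Require Import Rstruct Rstruct_topology.
Set Implicit Arguments. Unset Strict Implicit. Unset Printing Implicit Defensive.
Import Order.TTheory GRing.Theory Num.Theory.
Local Open Scope classical_set_scope.
Local Open Scope ring_scope.

Notation R := Rdefinitions.R.

Section Hilbert.
Variable V : lmodType R.
Variable ip : V -> V -> R.

Definition hnorm (x : V) : R := Num.sqrt (ip x x).

Definition h_complete : Prop :=
  forall u : nat -> V,
    (forall e : R, 0 < e -> exists N : nat,
        forall m n : nat, (N <= m)%N -> (N <= n)%N -> hnorm (u m - u n) < e) ->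
    exists l : V, forall e : R, 0 < e -> exists N : nat,
        forall n : nat, (N <= n)%N -> hnorm (u n - l) < e.

Record is_hilbert : Prop := IsHilbert {
  ip_sym : forall x y, ip x y = ip y x;
  ip_linl : forall (a : R) x y z, ip (a *: x + y) z = a * ip x z + ip y z;
  ip_ge0 : forall x, 0 <= ip x x;
  ip_eq0 : forall x, ip x x = 0 -> x = 0;
  ip_compl : h_complete
}.

Definition h_closed (A : set V) : Prop :=
  forall x, ~ A x -> exists e : R, 0 < e /\ forall y, hnorm (y - x) < e -> ~ A y.

Definition h_convex (A : set V) : Prop :=
  forall x y (l : R), A x -> A y -> 0 <= l -> l <= 1 -> A (l *: x + (1 - l) *: y).

Definition hdist (x : V) (A : set V) : R := inf [set hnorm (x - c) | c in A].

Definition is_metric_proj (A : set V) (x y : V) : Prop :=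
  A y /\ forall c, A c -> hnorm (x - y) <= hnorm (x - c).

Definition partial_weak_limit (x : nat -> V) (y : V) : Prop :=
  exists phi : nat -> nat, (forall k, (phi k < phi k.+1)%N) /\
    forall z : V, (fun k => ip (x (phi k)) z) @ \oo --> ip y z.

Definition remote_projections (Omega : Type) (C : Omega -> set V)
    (t : nat -> R) (x0 : V) (x : nat -> V) : Prop :=
  x 0%N = x0 /\
  exists alpha : nat -> Omega, forall n : nat,
    t n * sup [set hdist (x n) (C b) | b in [set: Omega]] <= hdist (x n) (C (alpha n))
    /\ is_metric_proj (C (alpha n)) (x n) (x n.+1).

Definition remote_max_attained (Omega : Type) (C : Omega -> set V) : Prop :=
  forall x : V, exists a : Omega, forall b : Omega, hdist x (C b) <= hdist x (C a).

Definition unit_sphere : set V := [set s | hnorm s = 1].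

Definition lin_span (D : set V) : set V :=
  [set x | exists (n : nat) (a : 'I_n -> R) (g : 'I_n -> V),
      (forall i, D (g i)) /\ x = \sum_(i < n) a i *: g i].

Definition dictionary (D : set V) : Prop :=
  D `<=` unit_sphere /\
  forall x : V, forall e : R, 0 < e -> exists y, lin_span D y /\ hnorm (x - y) < e.

Definition wga (D : set V) (t : nat -> R) (x0 : V) (x : nat -> V) : Prop :=
  x 0%N = x0 /\
  exists g : nat -> V, forall n : nat,
    D (g n) /\
    t n * sup [set `|ip (x n) h| | h in D] <= `|ip (x n) (g n)| /\
    x n.+1 = x n - ip (x n) (g n) *: g n.

Definition wga_max_attained (D : set V) : Prop :=
  forall x : V, exists g : V, D g /\ forall h : V, D h -> `|ip x h| <= `|ip x g|.

End Hilbert.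

Definition cond_i (t : nat -> R) : Prop :=
  forall M : R, exists N : nat, M < \sum_(n < N) t n ^+ 2.

Definition cond_ii (t : nat -> R) : Prop :=
  forall (V : lmodType R) (ip : V -> V -> R), is_hilbert ip ->
  forall (Omega : Type) (C : Omega -> set V),
    (exists a b : Omega, a <> b) ->
    (forall a, h_closed ip (C a) /\ h_convex (C a)) ->
    (exists c : V, forall a, C a c) ->
    ((exists n, t n = 1) -> remote_max_attained ip C) ->
  forall (x0 : V) (x : nat -> V), remote_projections ip C t x0 x ->
    exists y : V, (forall a, C a y) /\ partial_weak_limit ip x y.

Definition cond_iii (t : nat -> R) : Prop :=
  forall (V : lmodType R) (ip : V -> V -> R), is_hilbert ip ->
  forall D : set V, dictionary ip D ->
    ((exists n, t n = 1) -> wga_max_attained ip D) ->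
  forall (x0 : V) (x : nat -> V), wga ip D t x0 x ->
    partial_weak_limit ip x 0.

(* Main.v *)
(** (i) => (ii): projecting onto a convex set containing [c] decreases [|x - c|^2]
    by at least the square of the step, so [sum_n (t_n s_n)^2] is finite, where
    [s_n] is the largest distance from [x_n] to the sets; if [sum_n t_n^2] diverges,
    [s_n] tends to [0] along a subsequence.  A further subsequence converges weakly,
    and its limit lies in every [C_a] because closed convex sets are weakly closed.
    (ii) => (iii): a step of the greedy algorithm along [g] is the projection onto
    the hyperplane orthogonal to [g].
    (iii) => (i): if [sum_(n >= M) t_n^2 <= 1/2], work in [R^M * R^2] with the
    dictionary made of the axes of [R^M] and the unit circle of [R^2].  The first [M]
    steps, where [t_n = 1] may occur, erase the coordinates in [R^M]; afterwards each
    step moves along the circle direction that is just admissible and multiplies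
    [|x|^2] by [1 - t_n^2], so that [|x|^2] never drops below [1/2]. *)
Require Import Defs.
From mathcomp Require Import all_boot all_order all_algebra.
From mathcomp Require Import all_classical all_reals.
From mathcomp Require Import topology normedtype sequences Rstruct Rstruct_topology.
From mathcomp Require Import ring lra.
Set Implicit Arguments.
Unset Strict Implicit.
Unset Printing Implicit Defensive.
Import Order.TTheory GRing.Theory Num.Theory.
Import numFieldNormedType.Exports.
Local Open Scope classical_set_scope.
Local Open Scope ring_scope.

(** * Subsequences and real limits *)

Lemma exists_subseq (P : nat -> nat -> Prop) :
  (forall k N, exists n, (N < n)%N /\ P k n) ->
  exists phi : nat -> nat, (forall k, (phi k < phi k.+1)%N) /\ forall k, P k (phi k).
Proof.
move=> hP.
have /choice[f hf] : forall kN : nat * nat, exists n, (kN.2 < n)%N /\ P kN.1 n.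
  by move=> [k N]; exact: hP.
pose phi := fix phi k := if k is j.+1 then f (j.+1, phi j) else f (0, 0)%N.
exists phi; split=> [k|[|k]]; first by case: (hf (k.+1, phi k)).
- by case: (hf (0, 0)%N).
- by case: (hf (k.+1, phi k)).
Qed.

Lemma subseq_ge (phi : nat -> nat) : (forall k, (phi k < phi k.+1)%N) ->
  forall k, (k <= phi k)%N.
Proof. by move=> h; elim=> // k IH; exact: leq_ltn_trans IH (h k). Qed.

Lemma near_dist_lt (l e : R) : 0 < e -> \forall r \near l, `|r - l| < e.
Proof.
by move=> e0; apply/nbhs_ballP; exists e => //= r; rewrite distrC.
Qed.

Lemma cvg_seqP (u : nat -> R) (l : R) : u @ \oo --> l <->
  forall e, 0 < e -> exists N, forall n, (N <= n)%N -> `|u n - l| < e.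
Proof.
split=> [ul e e0|h].
  have := @cvgrPdist_lt R R^o nat \oo _ u l.
  move=> [/(_ ul e e0)[N _ hN] _]; exists N => n Nn.
  by rewrite distrC; exact: hN.
apply/(@cvgrPdist_lt R R^o) => e e0; have [N hN] := h e e0.
by exists N => // n /= Nn; rewrite distrC; exact: hN.
Qed.
Lemma invS_lt (e : R) : 0 < e -> exists N, forall n, (N <= n)%N -> n.+1%:R^-1 < e.
Proof.
move=> e0; exists (Num.truncn e^-1) => n Nn.
rewrite invf_plt ?posrE //; apply: lt_le_trans (truncnS_gt _) _.
by rewrite ler_nat ltnS.
Qed.

(** * Inner product calculus and the Cauchy-Schwarz inequality *)

Section InnerProduct.
Variables (V : lmodType R) (ip : V -> V -> R).
Hypothesis Hip : is_hilbert ip.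
Local Notation "`[ x ]" := (hnorm ip x) (format "`[ x ]").

Lemma ipC x y : ip x y = ip y x. Proof. exact: ip_sym Hip x y. Qed.

Lemma ipDl x y z : ip (x + y) z = ip x z + ip y z.
Proof. by have := ip_linl Hip 1 x y z; rewrite scale1r mul1r. Qed.

Lemma ip0l z : ip 0 z = 0.
Proof. by have := ipDl 0 0 z; rewrite addr0 => /esym/eqP; rewrite -subr_eq0 addrK => /eqP. Qed.

Lemma ipZl a x z : ip (a *: x) z = a * ip x z.
Proof. by have := ip_linl Hip a x 0 z; rewrite addr0 ip0l addr0. Qed.

Lemma ipNl x z : ip (- x) z = - ip x z.
Proof. by rewrite -scaleN1r ipZl mulN1r. Qed.

Lemma ipDr x y z : ip z (x + y) = ip z x + ip z y.
Proof. by rewrite ipC ipDl !(ipC _ z). Qed.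

Lemma ip0r z : ip z 0 = 0. Proof. by rewrite ipC ip0l. Qed.

Lemma ipZr a x z : ip z (a *: x) = a * ip z x.
Proof. by rewrite ipC ipZl (ipC _ z). Qed.

Lemma ipNr x z : ip z (- x) = - ip z x.
Proof. by rewrite ipC ipNl (ipC _ z). Qed.

Definition ipE := (ipDl, ipDr, ipNl, ipNr, ipZl, ipZr, ip0l, ip0r).

Lemma hnorm_ge0 x : 0 <= `[x]. Proof. exact: sqrtr_ge0. Qed.

Lemma sqr_hnorm x : `[x] ^+ 2 = ip x x.
Proof. by rewrite sqr_sqrtr // (ip_ge0 Hip). Qed.

Lemma hnorm0_eq0 x : `[x] = 0 -> x = 0.
Proof. by move=> x0; apply: (ip_eq0 Hip); rewrite -sqr_hnorm x0 expr0n. Qed.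

Lemma hnormN x : `[- x] = `[x].
Proof. by rewrite /hnorm !ipE opprK. Qed.

Lemma hnormZ a x : `[a *: x] = `|a| * `[x].
Proof.
by rewrite /hnorm !ipE mulrA -expr2 sqrtrM ?sqr_ge0 // sqrtr_sqr.
Qed.

Lemma hnorm0 : `[0] = 0. Proof. by rewrite /hnorm ip0l sqrtr0. Qed.

Lemma cauchy_schwarz x y : `|ip x y| <= `[x] * `[y].
Proof.
have [y0|yN0] := eqVneq (ip y y) 0.
  by rewrite (ip_eq0 Hip y0) ip0r normr0 hnorm0 mulr0.
have yy0 : 0 < ip y y by rewrite lt_def yN0 (ip_ge0 Hip).
rewrite -(ler_pXn2r (n := 2)) ?nnegrE ?mulr_ge0 ?hnorm_ge0 //.
rewrite exprMn !sqr_hnorm real_normK ?num_real //.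
have := ip_ge0 Hip (ip y y *: x - ip x y *: y).
rewrite !ipE (ipC y x) => h.
rewrite -(ler_pM2l yy0); nra.
Qed.

Lemma ler_hnormD x y : `[x + y] <= `[x] + `[y].
Proof.
rewrite -(ler_pXn2r (n := 2)) ?nnegrE ?addr_ge0 ?hnorm_ge0 //.
rewrite sqrrD !sqr_hnorm !ipE (ipC y x).
have := le_trans (ler_norm _) (cauchy_schwarz x y); lra.
Qed.

Lemma ler_hdist x y z : `[x - z] <= `[x - y] + `[y - z].
Proof. by rewrite -[x - z](subrKA y) ler_hnormD. Qed.

Lemma hnormBD_sqr x y : `[x - y] ^+ 2 = `[x] ^+ 2 - 2 * ip x y + `[y] ^+ 2.
Proof. by rewrite !sqr_hnorm !ipE (ipC y x); ring. Qed.

(** * Closed convex sets, distances and metric projections *)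

Lemma h_closedP (A : set V) :
  h_closed ip A <->
  forall x, (forall e, 0 < e -> exists2 y, A y & `[y - x] < e) -> A x.
Proof.
split=> [clA x xA|clA x nAx].
  apply: contrapT => /clA[e [e0 he]].
  by have [y Ay /he] := xA e e0.
apply: contrapT => h; apply/nAx/clA => e e0.
apply: contrapT => h2; apply: h; exists e; split => // y yx Ay.
by apply: h2; exists y.
Qed.

(** Moving from [p] towards [c] by a fraction [l] changes the squared distance to [x] by
    [l ^+ 2 * |c - p|^2 - 2 * l * a], with [a] the inner product in question. For [a > 0] this is
    negative once [l] is small, against the minimality of [p]. *)
Lemma metric_proj_le0 (A : set V) x p : h_convex A -> is_metric_proj ip A x p ->
  forall c, A c -> ip (x - p) (c - p) <= 0.
Proof.
move=> cA [Ap pmin] c Ac; rewrite leNgt; apply/negP => ip0.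
set a := ip (x - p) (c - p) in ip0.
have key l : 0 < l -> l <= 1 -> 2 * a <= l * ip (c - p) (c - p).
  move=> l0 l1.
  have := pmin _ (cA _ _ l Ac Ap (ltW l0) l1).
  have -> : x - (l *: c + (1 - l) *: p) = (x - p) - l *: (c - p).
    rewrite scalerBl scale1r scalerBr.
    by rewrite !opprD !opprK !addrA (addrAC x _ (- p)).
  rewrite -(ler_pXn2r (n := 2)) ?nnegrE ?hnorm_ge0 // (hnormBD_sqr (x - p)) hnormZ exprMn.
  rewrite real_normK ?num_real // !sqr_hnorm ipZr -/a => h.
  by rewrite -(ler_pM2l l0); lra.
have cc0 := ip_ge0 Hip (c - p).
set b := ip (c - p) (c - p) in key cc0.
(* This [l] satisfies [l * b <= a], hence contradicts [key]; the [+ 1] guards against [b = 0]. *)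
have l0 : 0 < Num.min 1 (a / (b + 1)).
  by rewrite lt_min ltr01 divr_gt0 // ltr_wpDl.
have := key _ l0; rewrite ge_min lexx => /(_ isT) h.
have : Num.min 1 (a / (b + 1)) * b <= a.
  apply: (@le_trans _ _ (a / (b + 1) * b)); first by rewrite ler_wpM2r // ge_min lexx orbT.
  rewrite mulrAC ler_pdivrMr; last by lra.
  by rewrite ler_pM2l //; lra.
lra.
Qed.

Lemma hdist_lb (A : set V) x : has_lbound [set `[x - c] | c in A].
Proof. by exists 0 => _ [c _ <-]; exact: hnorm_ge0. Qed.

Lemma hdist_le (A : set V) x c : A c -> hdist ip x A <= `[x - c].
Proof. by move=> Ac; apply: ge_inf; [exact: hdist_lb|exists c]. Qed.

Lemma hdist_ge (A : set V) x d : A !=set0 ->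
  (forall c, A c -> d <= `[x - c]) -> d <= hdist ip x A.
Proof.
move=> [c Ac] h; apply: lb_le_inf; first by exists `[x - c], c.
by move=> _ [c' Ac' <-]; exact: h.
Qed.

Lemma hdist_ge0 (A : set V) x : 0 <= hdist ip x A.
Proof.
have [[c Ac]|A0] := pselect (A !=set0).
  by apply: hdist_ge => [|? _]; [exists c|exact: hnorm_ge0].
(* For empty [A] the distance is the default value 0 of [inf]. *)
rewrite /hdist (_ : image _ _ = set0) ?inf0 // -subset0.
by move=> ? [c Ac _]; apply: A0; exists c.
Qed.

Lemma hdist_lt (A : set V) x e : A !=set0 -> hdist ip x A < e ->
  exists2 c, A c & `[x - c] < e.
Proof.
move=> [c Ac] xAe; have [|_ [c' Ac' <-] ?] := inf_lt _ xAe; last by exists c'.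
by exists `[x - c], c.
Qed.

Lemma hdist_proj (A : set V) x p : is_metric_proj ip A x p ->
  hdist ip x A = `[x - p].
Proof.
move=> [Ap pmin]; apply/eqP; rewrite eq_le hdist_le //=.
by apply: hdist_ge => //; exists p.
Qed.

(** A minimizing sequence is Cauchy: the midpoint of [u m] and [u n] stays in [A], hence at distance
    at least [d] from [x], and the parallelogram law then bounds [|u m - u n|]. Completeness gives
    the limit, closedness puts it in [A]. *)
Lemma metric_proj_exists (A : set V) x : h_closed ip A -> h_convex A ->
  A !=set0 -> exists p, is_metric_proj ip A x p.
Proof.
move=> clA cA A0; set d := hdist ip x A.
have d0 : 0 <= d by exact: hdist_ge0.
have /choice[u hu] : forall n : nat, exists c, A c /\ `[x - c] < d + n.+1%:R^-1.
  move=> n; have [|c Ac ?] := @hdist_lt A x (d + n.+1%:R^-1) A0.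
    by rewrite ltrDl invr_gt0.
  by exists c.
have uA n : A (u n) by case: (hu n).
have usq n : `[x - u n] ^+ 2 <= d ^+ 2 + (2 * d + 1) * n.+1%:R^-1.
  have [_ /ltW hn] := hu n.
  have h1 : n.+1%:R^-1 <= 1 :> R by rewrite invf_le1 ?ler1n.
  have h0 : 0 <= n.+1%:R^-1 :> R by rewrite invr_ge0.
  have hx := hnorm_ge0 (x - u n).
  set e := n.+1%:R^-1 in hn h1 h0 *.
  nra.
have par m n : `[u m - u n] ^+ 2 <= 2 * (2 * d + 1) * (m.+1%:R^-1 + n.+1%:R^-1).
  have Ac : A (2^-1 *: u m + (1 - 2^-1) *: u n).
    by apply: cA => //; lra.
  have /= := hdist_le x Ac; rewrite -/d.
  rewrite -(ler_pXn2r (n := 2)) ?nnegrE ?hnorm_ge0 //.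
  have := usq m; have := usq n; rewrite !sqr_hnorm !ipE.
  rewrite !(ipC (u _) x) (ipC (u n) (u m)).
  move: (n.+1%:R^-1 : R) (m.+1%:R^-1 : R) => a b.
  lra.
have [p hp] : exists l, forall e : R, 0 < e -> exists N : nat,
    forall n : nat, (N <= n)%N -> `[u n - l] < e.
  apply: (ip_compl Hip) => e e0.
  (* With [N.+1 > K], the bound [par] falls below [e ^+ 2] for all indices from [N] on. *)
  pose K := 4 * (2 * d + 1) / e ^+ 2.
  have K0 : 0 <= K by rewrite divr_ge0 ?sqr_ge0 //; lra.
  have [N hN] : exists N : nat, K < N.+1%:R.
    exists (Num.truncn K); exact: truncnS_gt.
  exists N => m n Nm Nn.
  rewrite -(ltr_pXn2r (n := 2)) ?nnegrE ?hnorm_ge0 ?ltW //.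
  apply: le_lt_trans (par m n) _.
  have lem k : (N <= k)%N -> k.+1%:R^-1 <= N.+1%:R^-1 :> R.
    by move=> Nk; rewrite lef_pV2 ?posrE // ler_nat.
  have le2 := lerD (lem _ Nm) (lem _ Nn).
  apply: (@le_lt_trans _ _ (4 * (2 * d + 1) * N.+1%:R^-1)).
    rewrite (_ : 4 * _ * _ = 2 * (2 * d + 1) * (N.+1%:R^-1 + N.+1%:R^-1)); last by ring.
    by rewrite ler_wpM2l //; lra.
  by rewrite ltr_pdivrMr // [ltRHS]mulrC -ltr_pdivrMr ?exprn_gt0.
have small n (e : R) : 0 < e -> exists2 k : nat, (n <= k)%N & k.+1%:R^-1 < e.
  move=> e0; exists (n + Num.truncn e^-1)%N; first exact: leq_addr.
  rewrite invf_plt ?posrE //; apply: lt_le_trans (truncnS_gt _) _.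
  by rewrite ler_nat ltnS leq_addl.
exists p; split.
  apply: ((h_closedP A).1 clA) => e e0; have [N hN] := hp e e0.
  by exists (u N) => //; exact: hN.
move=> c Ac; apply: le_trans (hdist_le x Ac); rewrite -/d.
apply/ler_addgt0Pr => e e0.
have e20 : 0 < e / 2 by lra.
have [N hN] := hp _ e20.
have [n Nn hn] := small N _ e20.
have := ler_hdist x (u n) p.
have [_] := hu n; have := hN n Nn; move: hn.
by move: (n.+1%:R^-1 : R) => a; lra.
Qed.

(** * Riesz representation and weak sequential compactness *)

Lemma riesz (L : V -> R) K : (forall a z w, L (a *: z + w) = a * L z + L w) ->
  (forall z, `|L z| <= K * `[z]) -> exists y, forall z, L z = ip y z.
Proof.
move=> Llin Lbd.
have L0 : L 0 = 0.
  by have := Lbd 0; rewrite hnorm0 mulr0 normr_le0 => /eqP.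
have LZ a z : L (a *: z) = a * L z by rewrite -[a *: z]addr0 Llin L0 addr0.
have LD z w : L (z + w) = L z + L w by rewrite -[z]scale1r Llin scale1r mul1r.
have LN z : L (- z) = - L z by rewrite -scaleN1r LZ mulN1r.
have [[z0 Lz0]|nz] := pselect (exists z, L z != 0); last first.
  exists 0 => z; rewrite ip0l; apply/eqP/negPn/negP => Lz.
  by apply: nz; exists z.
(* The point [p] of this affine hyperplane nearest to 0 is orthogonal to the kernel of [L], so a
   multiple of it represents [L]. *)
pose A := [set z | L z = 1].
have [p [Ap pmin]] : exists p, is_metric_proj ip A 0 p.
  apply: metric_proj_exists; last first.
  - by exists ((L z0)^-1 *: z0); rewrite /A /= LZ mulVf.
  - by move=> u v l; rewrite /A /= LD !LZ => -> -> _ _; rewrite !mulr1 subrKC.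
  apply/h_closedP => u uA; rewrite /A /=; apply/eqP; rewrite -subr_eq0 -normr_eq0.
  apply: contrapT => /negP; rewrite -normr_gt0 normr_id => e0.
  have K0 : 0 < `|K| + 1 by rewrite ltr_wpDl.
  have [v Av] := uA _ (divr_gt0 e0 K0).
  rewrite ltr_pdivlMr // => vu; move: (vu).
  have := Lbd (v - u); rewrite LD LN Av distrC.
  have := ler_norm K; have := hnorm_ge0 (v - u).
  by move: (`[v - u]) => r *; nra.
have orth w : L w = 0 -> ip p w = 0.
  move=> Lw.
  (* Since [p + v] remains in [A], the projection inequality gives one sign; applying it to [- w] as
     well gives equality. *)
  have half v : L v = 0 -> 0 <= ip p v.
    move=> Lv; have := @metric_proj_le0 A 0 p _ _ (p + v).
    rewrite sub0r addrAC subrr add0r ipNl oppr_le0; apply => //.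
      by move=> u v' l; rewrite /A /= LD !LZ => -> -> _ _; rewrite !mulr1 subrKC.
    by rewrite /A /= LD Ap Lv addr0.
  apply/eqP; rewrite eq_le half // andbT -oppr_ge0 -ipNr.
  by rewrite half // LN Lw oppr0.
have pp : ip p p != 0.
  apply/eqP => /(ip_eq0 Hip) p0.
  by have := Ap; rewrite /A /= p0 L0 => /esym/eqP; rewrite oner_eq0.
exists ((ip p p)^-1 *: p) => z.
have := orth (z - L z *: p); rewrite LD LN LZ Ap mulr1 subrr => /(_ erefl).
rewrite !ipE => /eqP; rewrite subr_eq0 => /eqP ->.
by rewrite mulrC mulfK.
Qed.

(** The functionals [ip (x n)] lie in a product of segments, compact by Tychonoff. A cluster point
    [L] for pointwise convergence inherits linearity and the bound [B], so Riesz turns it into a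
    vector. Only finitely many test vectors are controlled at once, hence the list [s]. *)
Lemma weak_cluster_point (x : nat -> V) B : (forall n, `[x n] <= B) ->
  exists y, forall (s : seq V) (e : R) (N : nat), 0 < e ->
    exists n, (N < n)%N /\ forall z, z \in s -> `|ip (x n) z - ip y z| < e.
Proof.
move=> xB.
have [|L [hL cl]] := @tychonoff V (fun=> R : topologicalType)
    (fun z => `[- (B * `[z]), B * `[z]]%classic) (fun z => @segment_compact _ _ _)
    ((fun n (z : V) => ip (x n) z) @ \oo) _.
  exists 0%N => // n _ z /=; rewrite in_itv /= -ler_norml.
  apply: le_trans (cauchy_schwarz _ _) _.
  by rewrite ler_wpM2r // hnorm_ge0.
have app (s : seq V) (e : R) (N : nat) : 0 < e ->
    exists n, (N < n)%N /\ forall z, z \in s -> `|ip (x n) z - L z| < e.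
  move=> e0.
  have [||f [[n Nn <-] hn]] := cl [set f | exists2 n, (N < n)%N & ip (x n) = f]
     [set f | forall z, z \in s -> `|f z - L z| < e].
  - by exists N.+1 => // n /= Nn; exists n.
  - elim: s => [|a s IH]; first by apply: filterS filterT.
    have : \forall f \near L, `|f a - L a| < e.
      exact: (@proj_continuous V (fun=> R : topologicalType) a L _ (near_dist_lt (L a) e0)).
    apply: filterS2 IH => f fs fa z; rewrite inE => /predU1P[->//|]; exact: fs.
  by exists n.
suff [y Ly] : exists y, forall z, L z = ip y z.
  by exists y => s e N /(app s e N)[n [Nn h]]; exists n; split => // z /h; rewrite Ly.
apply: (@riesz _ B) => [a z w|z].
  apply/eqP; rewrite -subr_eq0 -normr_eq0 -[_ == _]negbK -normr_gt0 normr_id.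
  apply/negP => d0; set d := `|_| in d0.
  (* One [x n] approximates [L] at three vectors; the errors enter the linearity defect with weights
     1, [|a|] and 1, whose sum is [2 + |a|]. *)
  have a0 : 0 < 2 + `|a| by rewrite ltr_wpDr.
  have [n [_ h]] := app [:: a *: z + w; z; w] _ 0%N (divr_gt0 d0 a0).
  set e := d / _ in h.
  have de : d = e * (2 + `|a|) by rewrite /e divfK // gt_eqF.
  have h1 : `|ip (x n) (a *: z + w) - L (a *: z + w)| < e by apply: h; rewrite !inE eqxx.
  have h2 : `|ip (x n) z - L z| < e by apply: h; rewrite !inE eqxx orbT.
  have h3 : `|ip (x n) w - L w| < e by apply: h; rewrite !inE eqxx !orbT.
  have : d < e + `|a| * e + e; last first.
    by rewrite (_ : e + _ + e = d) ?ltxx // de; ring.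
  rewrite /d (_ : _ - _ = - (ip (x n) (a *: z + w) - L (a *: z + w))
      + a * (ip (x n) z - L z) + (ip (x n) w - L w)); last by rewrite !ipE; ring.
  apply: le_lt_trans (ler_normD _ _) _; apply: ltr_leD _ (ltW h3).
  apply: le_lt_trans (ler_normD _ _) _; rewrite normrN normrM.
  by apply: ltr_leD => //; rewrite ler_wpM2l // ltW.
by have := hL z; rewrite /= in_itv /= ler_norml.
Qed.

(** No separability is assumed. The index [phi k] is chosen by testing only against [y] and the
    earlier [x m]. The set [W] of vectors where convergence holds is then a closed subspace
    containing [y] and every [x n]; a vector orthogonal to [W] has zero inner product with all of
    these, so it belongs to [W] too, and [W] is the whole space. *)
Lemma bounded_partial_weak_limit (x : nat -> V) B : (forall n, `[x n] <= B) ->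
  exists y, partial_weak_limit ip x y.
Proof.
move=> xB; have [y hy] := weak_cluster_point xB; exists y.
have [phi [phiS hphi]] : exists phi : nat -> nat, (forall k, (phi k < phi k.+1)%N) /\
    forall k z, z \in y :: [seq x m | m <- iota 0 k] ->
      `|ip (x (phi k)) z - ip y z| < k.+1%:R^-1.
  apply: (@exists_subseq (fun k n => forall z, z \in y :: [seq x m | m <- iota 0 k] ->
      `|ip (x n) z - ip y z| < k.+1%:R^-1)) => k N.
  by apply: hy; rewrite invr_gt0.
exists phi; split=> //.
pose W := [set z | (fun k => ip (x (phi k)) z) @ \oo --> ip y z].
have harm z N : (forall k, (N < k)%N -> z \in y :: [seq x m | m <- iota 0 k]) -> W z.
  move=> zk; apply/cvg_seqP => e e0; have [M hM] := invS_lt e0.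
  exists (maxn M N.+1) => k; rewrite geq_max => /andP[Mk Nk].
  exact: lt_trans (hphi _ _ (zk k Nk)) (hM k Mk).
have Wy : W y by apply: (harm y 0%N) => k _; rewrite inE eqxx.
have Wx n : W (x n).
  apply: (harm (x n) n) => k nk; rewrite inE; apply/orP; right.
  by apply/mapP; exists n => //; rewrite mem_iota.
have WD a z w : W z -> W w -> W (a *: z + w).
  move=> Wz Ww; rewrite /W /=; under eq_fun do rewrite ipDr ipZr.
  rewrite ipDr ipZr; apply: (@cvgD R R^o) => //.
  by apply: (@cvgM R) => //; exact: cvg_cst.
have WZ a z : W z -> W (a *: z).
  move=> Wz; rewrite /W /=; under eq_fun do rewrite ipZr.
  by rewrite ipZr; apply: (@cvgM R) => //; exact: cvg_cst.
move=> z; change (W z).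
have [p [Wp pmin]] : exists p, is_metric_proj ip W z p.
  apply: metric_proj_exists; last by exists y.
    apply/h_closedP => u uW; apply/cvg_seqP => e e0.
    have B0 : 0 <= B := le_trans (hnorm_ge0 _) (xB 0%N).
    (* [b] bounds [|x (phi k) - y|] uniformly in [k], so replacing [u] by a nearby [w] in [W] costs
       less than [e / 2]. *)
    set b := B + `[y] + 1.
    have b0 : 0 < b by rewrite ltr_wpDl // addr_ge0 // hnorm_ge0.
    have e20 : 0 < e / 2 by lra.
    have [w] := uW _ (divr_gt0 e20 b0) => /cvg_seqP/(_ _ e20)[M hM] wu.
    exists M => k /hM h.
    rewrite (_ : _ - _ = (ip (x (phi k)) w - ip y w) - ip (x (phi k) - y) (w - u));
      last by rewrite !ipE; ring.
    apply: le_lt_trans (ler_normB _ _) _.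
    have := cauchy_schwarz (x (phi k) - y) (w - u).
    have := ler_hnormD (x (phi k)) (- y); rewrite hnormN => h1.
    have h2 := xB (phi k).
    have h3 := hnorm_ge0 (w - u).
    move: wu; rewrite ltr_pdivlMr // => wu h4.
    have : `[x (phi k) - y] * `[w - u] <= b * `[w - u].
      by rewrite ler_wpM2r // /b; lra.
    lra.
  by move=> u v l Wu Wv _ _; apply: WD => //; exact: WZ.
have orth w : W w -> ip (z - p) w = 0.
  move=> Ww.
  have half v : W v -> ip (z - p) v <= 0.
    move=> Wv; have := @metric_proj_le0 W z p _ _ (v + p).
    rewrite addrK; apply => //.
      by move=> u u' l Wu Wu' _ _; apply: WD => //; exact: WZ.
    by rewrite -[v]scale1r; apply: WD.
  apply/eqP; rewrite eq_le half //= -oppr_le0 -ipNr half //.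
  by rewrite -scaleN1r; exact: WZ.
(* Along [z - p] both the sequence and its expected limit are identically 0. *)
have Wzp : W (z - p).
  rewrite /W /= ipC orth //; under eq_fun do rewrite ipC orth //.
  exact: cvg_cst.
by rewrite -(subrK p z) -[z - p]scale1r; exact: WD.
Qed.

(** Let [p] be the projection of [y] and [z = y - p]. Then [ip z z] splits into three terms: one
    small by weak convergence, one small because [x M] is near some [c] in [A], and [ip z (c - p)],
    which is at most 0 by the projection inequality. *)
Lemma weak_limit_mem (A : set V) (x : nat -> V) y :
  h_closed ip A -> h_convex A -> A !=set0 ->
  (forall z, (fun k => ip (x k) z) @ \oo --> ip y z) ->
  (fun k => hdist ip (x k) A) @ \oo --> (0 : R) -> A y.
Proof.
move=> clA cA A0 xy xA; have [p pP] := metric_proj_exists y clA cA A0.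
suff yp : y - p = 0 by move/eqP: yp; rewrite subr_eq0 => /eqP ->; case: pP.
apply: (ip_eq0 Hip); apply/eqP; rewrite eq_le (ip_ge0 Hip) andbT.
apply/ler_addgt0Pr => e e0; rewrite add0r; set z := y - p.
have e20 : 0 < e / 2 by lra.
have z0 : 0 < `[z] + 1 by rewrite ltr_wpDl // hnorm_ge0.
have /cvg_seqP/(_ _ e20)[M1 h1] := xy z.
have /cvg_seqP/(_ _ (divr_gt0 e20 z0))[M2 h2] := xA.
set M := maxn M1 M2; have h3 := h1 M (leq_maxl _ _); have := h2 M (leq_maxr _ _).
rewrite subr0 ger0_norm ?hdist_ge0 //.
move=> /(hdist_lt A0)[c Ac]; rewrite ltr_pdivlMr // => h4.
have h5 := metric_proj_le0 cA pP Ac.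
have h6 := le_trans (ler_norm _) (cauchy_schwarz z (x M - c)).
have h7 : ip y z - ip (x M) z < e / 2 by apply: ltr_normlW; rewrite distrC.
have -> : ip z z = (ip y z - ip (x M) z) + ip z (x M - c) + ip z (c - p).
  by rewrite -!(ipC z) /z !ipE; ring.
move: h4 h5 h6 h7; rewrite -/z; have := hnorm_ge0 (x M - c).
rewrite (mulrC `[z]) mulrDr mulr1; lra.
Qed.

(** Expanding [|x - c|^2] around [p] leaves the cross term [- 2 * ip (x - p) (c - p)], which is
    nonnegative. *)
Lemma fejer (A : set V) x p c : h_convex A -> is_metric_proj ip A x p -> A c ->
  `[p - c] ^+ 2 + `[x - p] ^+ 2 <= `[x - c] ^+ 2.
Proof.
move=> cA pP Ac; have := metric_proj_le0 cA pP Ac.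
rewrite !sqr_hnorm !ipE !(ipC _ x) (ipC c p); lra.
Qed.

End InnerProduct.

(** * Remote projections: (i) implies (ii) *)

Lemma exists_small_factor (t s : nat -> R) (K : R) : cond_i t ->
  (forall m, \sum_(n < m) (t n * s n) ^+ 2 <= K) ->
  forall (e : R) N, 0 < e -> exists n, (N < n)%N /\ s n < e.
Proof.
move=> ti tsK e N e0; apply: contrapT => nex.
have es n : (N < n)%N -> e <= s n.
  by move=> Nn; rewrite leNgt; apply/negP => sne; apply: nex; exists n.
(* If [s n >= e] past [N], the terms [(t n * s n) ^+ 2] there dominate [e ^+ 2 * t n ^+ 2], whose
   sum diverges while the left one stays below [K]. *)
have grow m : e ^+ 2 * \sum_(n < N.+1 + m) t n ^+ 2 <=
    e ^+ 2 * \sum_(n < N.+1) t n ^+ 2 + \sum_(n < N.+1 + m) (t n * s n) ^+ 2.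
  elim: m => [|m IH].
    by rewrite addn0 lerDl sumr_ge0 // => i _; exact: sqr_ge0.
  rewrite addnS !(@big_ord_recr _ _ _ (N.+1 + m)) /= mulrDr addrA lerD // mulrC exprMn.
  have es1 : e <= s (N.+1 + m)%N by rewrite es // leq_addr.
  by rewrite ler_wpM2l ?sqr_ge0 // lerXn2r ?nnegrE ?(ltW e0) // (le_trans (ltW e0)).
have [m hm] := ti (\sum_(n < N.+1) t n ^+ 2 + K / e ^+ 2).
have tm : \sum_(n < m) t n ^+ 2 <= \sum_(n < N.+1 + m) t n ^+ 2.
  by rewrite addnC big_split_ord /= lerDl sumr_ge0 // => i _; exact: sqr_ge0.
have e20 : 0 < e ^+ 2 by rewrite exprn_gt0.
have := lt_le_trans hm tm; rewrite -(ltr_pM2l e20) mulrDr mulrCA divff ?gt_eqF // mulr1.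
by apply/negP; rewrite -leNgt (le_trans (grow m)) // lerD2l.
Qed.

Section RemoteProjections.
Variables (V : lmodType R) (ip : V -> V -> R) (Omega : Type) (C : Omega -> set V).
Hypotheses (Hip : is_hilbert ip) (C_closed : forall a, h_closed ip (C a)).
Hypothesis C_convex : forall a, h_convex (C a).
Variables (c : V) (Cc : forall a, C a c) (t : nat -> R) (x0 : V) (x : nat -> V).
Hypotheses (t_ge0 : forall n, 0 <= t n) (rp : remote_projections ip C t x0 x).
Local Notation "`[ x ]" := (hnorm ip x) (format "`[ x ]").
Let s n := sup [set hdist ip (x n) (C b) | b in [set: Omega]].

(** The common point [c] bounds all distances by [|x n - c|], so [s n] is a true supremum even for
    infinite [Omega]. *)
Lemma hdist_le_sup n a : hdist ip (x n) (C a) <= s n.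
Proof.
apply: ub_le_sup; last by exists a.
by exists `[x n - c] => _ [b _ <-]; exact: hdist_le.
Qed.

Lemma remote_step n : `[x n.+1 - c] ^+ 2 + (t n * s n) ^+ 2 <= `[x n - c] ^+ 2.
Proof.
have [_ [alpha /(_ n)[ts pr]]] := rp.
have q := fejer Hip (@C_convex _) pr (Cc (alpha n)); apply: le_trans q; rewrite lerD2l.
rewrite lerXn2r ?nnegrE ?hnorm_ge0 // -?(hdist_proj pr) //.
by rewrite mulr_ge0 // (le_trans (hdist_ge0 ip (C (alpha n)) _) (hdist_le_sup n _)).
Qed.

Lemma remote_sum m : `[x m - c] ^+ 2 + \sum_(n < m) (t n * s n) ^+ 2 <= `[x0 - c] ^+ 2.
Proof.
elim: m => [|m IH]; first by have [-> _] := rp; rewrite big_ord0 addr0.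
apply: le_trans IH; rewrite big_ord_recr /= addrCA [leRHS]addrC lerD2l.
exact: remote_step.
Qed.

Lemma remote_partial_weak_limit : cond_i t ->
  exists y, (forall a, C a y) /\ partial_weak_limit ip x y.
Proof.
move=> ti.
have xB n : `[x n] <= `[x0 - c] + `[c].
  rewrite -{1}(subrK c (x n)); apply: le_trans (ler_hnormD Hip _ _) _; rewrite lerD2r.
  rewrite -(ler_pXn2r (n := 2)) ?nnegrE ?hnorm_ge0 //.
  by apply: le_trans (remote_sum n); rewrite lerDl sumr_ge0 // => i _; exact: sqr_ge0.
have small : forall k N, exists n, (N < n)%N /\ s n < k.+1%:R^-1.
  move=> k N; apply: (@exists_small_factor t s (`[x0 - c] ^+ 2)); rewrite ?invr_gt0 // => m.
  by apply: le_trans (remote_sum m); rewrite lerDr sqr_ge0.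
(* Two extractions: [phi] makes the distances tend to 0, then [psi] gives weak convergence;
   [psi k >= k] preserves the rate of the first. *)
have [phi [phiS sphi]] := exists_subseq small.
have [y [psi [psiS wy]]] := bounded_partial_weak_limit Hip (fun k => xB (phi k)).
have phi_mono : {homo phi : i j / (i < j)%N} by apply: homo_ltn phiS; exact: ltn_trans.
exists y; split; last by exists (phi \o psi); split=> // k /=; exact: phi_mono.
move=> a; apply: (@weak_limit_mem _ _ Hip (C a) (fun k => x (phi (psi k)))) => //.
  by exists c.
apply/cvg_seqP => e e0; have [N hN] := invS_lt e0; exists N => k Nk.
rewrite subr0 ger0_norm ?hdist_ge0 //.
apply: le_lt_trans (hdist_le_sup _ _) (lt_trans (sphi _) _).
by apply: hN; apply: leq_trans Nk _; exact: subseq_ge.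
Qed.

End RemoteProjections.

Lemma cond_i_ii (t : nat -> R) : (forall n, 0 <= t n) -> cond_i t -> cond_ii t.
Proof.
move=> t0 ti V ip Hip Omega C _ clC [c Cc] _ x0 x rp.
apply: (@remote_partial_weak_limit V ip Omega C Hip _ _ c Cc t x0 x) => // a.
- by case: (clC a).
- by case: (clC a).
Qed.

(** * Hyperplanes and dictionaries: (ii) implies (iii) *)

Section Hyperplane.
Variables (V : lmodType R) (ip : V -> V -> R).
Hypothesis Hip : is_hilbert ip.
Local Notation "`[ x ]" := (hnorm ip x) (format "`[ x ]").

Definition hyperplane (h : V) : set V := [set c | ip c h = 0].

Lemma hyperplane_convex h : h_convex (hyperplane h).
Proof.
move=> x y l; rewrite /hyperplane /= => xh yh _ _.
by rewrite !(ipE Hip) xh yh !mulr0 addr0.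
Qed.

Lemma hyperplane_proj h x : `[h] = 1 ->
  is_metric_proj ip (hyperplane h) x (x - ip x h *: h).
Proof.
move=> h1; have hh : ip h h = 1 by rewrite -sqr_hnorm // h1 expr1n.
split; first by rewrite /hyperplane /= !(ipE Hip) hh mulr1 subrr.
move=> c; rewrite /hyperplane /= => ch; rewrite subKr hnormZ // h1 mulr1.
have := cauchy_schwarz Hip (x - c) h.
by rewrite !(ipE Hip) ch subr0 h1 mulr1.
Qed.

Lemma hyperplane_hdist h x : `[h] = 1 -> hdist ip x (hyperplane h) = `|ip x h|.
Proof.
move=> h1; rewrite (hdist_proj (hyperplane_proj x h1)) subKr hnormZ // h1.
by rewrite mulr1.
Qed.

Lemma hyperplane_closed h : h_closed ip (hyperplane h).
Proof.
apply/h_closedP => x xh; rewrite /hyperplane /=; apply/eqP; rewrite -normr_le0.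
have h0 : 0 < `[h] + 1 by rewrite ltr_wpDl // hnorm_ge0.
apply/ler_addgt0Pr => e e0; rewrite add0r.
have [c] := xh _ (divr_gt0 e0 h0); rewrite /hyperplane /= ltr_pdivlMr // => ch cx.
have := cauchy_schwarz Hip (c - x) h; rewrite !(ipE Hip) ch sub0r normrN => h1.
have := hnorm_ge0 ip (c - x); move: cx; rewrite mulrDr mulr1; lra.
Qed.

(** Such a [y] is orthogonal to the span. For [v] in the span,
    [|y|^2 = ip (y - v) y <= |y - v| * |y|], so [|y|] is at most the approximation error. *)
Lemma dictionary_orthogonal (D : set V) y : dictionary ip D ->
  (forall h, D h -> ip y h = 0) -> y = 0.
Proof.
move=> [_ dense] yD; apply: (hnorm0_eq0 Hip).
apply/eqP; rewrite eq_le hnorm_ge0 andbT.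
apply/ler_addgt0Pr => e e0; rewrite add0r.
have [_ [[n [a [g [Dg ->]]]]]] := dense y e e0; set v := \sum_(i < n) _ => yv.
have yv0 : ip y v = 0.
  rewrite /v; elim/big_ind : _ => [|u w yu yw|i _]; first exact: ip0r.
    by rewrite (ipDr Hip) yu yw addr0.
  by rewrite (ipZr Hip) yD // mulr0.
have [->|y0] := eqVneq `[y] 0; first exact: ltW.
have yp : 0 < `[y] by rewrite lt_def y0 hnorm_ge0.
apply: le_trans (ltW yv); rewrite -(ler_pM2r yp) -expr2 sqr_hnorm //.
have := le_trans (ler_norm _) (cauchy_schwarz Hip (y - v) y).
by rewrite !(ipE Hip) (ipC Hip v) yv0 subr0.
Qed.

End Hyperplane.

(* Tagging each [h] in [D] with a boolean makes the index set have at least two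
   elements even when [D] is a singleton. *)
Lemma cond_ii_iii (t : nat -> R) : cond_ii t -> cond_iii t.
Proof.
move=> tii V ip Hip D dictD Dmax x0 x [x00 [g wg]].
pose Omega : Type := ({h : V | D h} * bool)%type.
pose C (a : Omega) := hyperplane ip (sval a.1).
have D1 h : D h -> hnorm ip h = 1 by move=> Dh; exact: dictD.1.
have distC y a : hdist ip y (C a) = `|ip y (sval a.1)|.
  by rewrite hyperplane_hdist //; exact: D1 (svalP a.1).
pose alpha b n : Omega := (exist _ (g n) (wg n).1, b).
have [|||||y [Cy xy]] := tii V ip Hip Omega C _ _ _ _ x0 x.
- by exists (alpha true 0%N), (alpha false 0%N).
- by move=> a; split; [exact: hyperplane_closed|exact: hyperplane_convex].
- by exists 0 => a; rewrite /C /hyperplane /= ip0l.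
- move=> /Dmax maxD y; have [h [Dh hmax]] := maxD y.
  by exists (exist _ h Dh, true) => b; rewrite !distC; apply: hmax; exact: svalP.
- split=> //; exists (alpha true) => n; have [Dg [tg ->]] := wg n; split; last first.
    exact: hyperplane_proj (D1 _ Dg).
  rewrite distC /=; apply: le_trans tg.
  rewrite (_ : [set hdist _ _ _ | b in _] = [set `|ip (x n) h| | h in D]) //.
  apply/seteqP; split=> _ [a Da <-].
    by rewrite distC; exists (sval a.1) => //; exact: svalP.
  by exists (exist _ a Da, true) => //; rewrite distC.
suff <- : y = 0 by [].
apply: (dictionary_orthogonal Hip dictD) => h Dh.
exact: (Cy (exist _ h Dh, true)).
Qed.

(** * Euclidean spaces as Hilbert spaces *)

Lemma cauchy_seq_cvg (u : nat -> R) :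
  (forall e : R, 0 < e -> exists N, forall m n, (N <= m)%N -> (N <= n)%N ->
     `|u m - u n| < e) -> exists l : R, u @ \oo --> l.
Proof.
move=> uC; exists (lim (u @ \oo)); apply: (@cauchy_cvg R^o).
apply/(@cauchy_exP R R^o) => e e0; have [N hN] := uC e e0.
by exists (u N), N => // n Nn; exact: hN.
Qed.

Definition dot n (u v : 'rV[R]_n) : R := \sum_i u 0 i * v 0 i.

Lemma dot_hilbert n : is_hilbert (@dot n).
Proof.
have ge0 x : 0 <= dot x x :> R by apply: sumr_ge0 => i _; rewrite -expr2 sqr_ge0.
have coord (x : 'rV[R]_n) i : `|x 0 i| <= hnorm (@dot n) x.
  rewrite -sqrtr_sqr ler_wsqrtr // /dot (bigD1 i) //= expr2 lerDl.
  by apply: sumr_ge0 => j _; rewrite -expr2 sqr_ge0.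
split=> //.
- by move=> x y; apply: eq_bigr => i _; rewrite mulrC.
- move=> a x y z; rewrite mulr_sumr -big_split; apply: eq_bigr => i _.
  by rewrite !mxE mulrDl mulrA.
- move=> x x0; apply/rowP => i; apply/eqP; rewrite mxE -normr_le0.
  by apply: le_trans (coord x i) _; rewrite /hnorm x0 sqrtr0.
move=> u uC.
have /choice[l ul] : forall i, exists l : R, (fun k => u k 0 i) @ \oo --> l.
  move=> i; apply: cauchy_seq_cvg => e /uC[N hN]; exists N => p q Np Nq.
  by apply: le_lt_trans (hN p q Np Nq); have := coord (u p - u q) i; rewrite !mxE.
exists (\row_i l i) => e e0.
(* Coordinatewise error [d] gives squared norm at most [n * d ^+ 2], below [e ^+ 2] since
   [n < n.+1 ^ 2]; this also covers [n = 0]. *)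
have [d d0 de] : exists2 d, 0 < d & e = d * n.+1%:R.
  by exists (e / n.+1%:R); rewrite ?divr_gt0 // divfK ?pnatr_eq0.
have /choice[N hN] : forall i, exists N, forall k, (N <= k)%N -> `|u k 0 i - l i| < d.
  by move=> i; exact: (cvg_seqP _ _).1 (ul i) d d0.
exists (\max_i N i)%N => k Nk.
rewrite -(ltr_pXn2r (n := 2)) ?nnegrE ?sqrtr_ge0 ?(ltW e0) // sqr_sqrtr //.
apply: (@le_lt_trans _ _ (\sum_(i < n) d ^+ 2)).
  apply: ler_sum => i _; rewrite !mxE -expr2 -real_normK ?num_real //.
  rewrite lerXn2r ?nnegrE ?(ltW d0) // ltW // hN //.
  exact: leq_trans (leq_bigmax _) Nk.
rewrite sumr_const card_ord de exprMn -[ltLHS]mulr_natr ltr_pM2l ?exprn_gt0 // -natrX ltr_nat.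
by rewrite expnS mulSn ltn_addr // muln1.
Qed.

Lemma dot_row_mx m n (u u' : 'rV_m) (v v' : 'rV_n) :
  dot (row_mx u v) (row_mx u' v') = dot u u' + dot v v'.
Proof.
rewrite /dot big_split_ord /=; congr (_ + _); apply: eq_bigr => i _.
  by rewrite !row_mxEl.
by rewrite !row_mxEr.
Qed.

Lemma dot_delta n (u : 'rV_n) i : dot u (delta_mx 0 i) = u 0 i.
Proof.
rewrite /dot (bigD1 i) //= big1 ?addr0 ?mxE ?eqxx ?mulr1 // => j ji.
by rewrite mxE (negPf ji) andbF mulr0.
Qed.

(** * The counterexample: (iii) implies (i) *)

Lemma partial_sum_tail (t : nat -> R) : ~ cond_i t ->
  exists M, forall k, \sum_(j < k) t (M + j)%N ^+ 2 <= 2^-1.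
Proof.
move=> nti.
have [B SB] : exists B, forall N, \sum_(n < N) t n ^+ 2 <= B.
  apply: contrapT => h; apply: nti => B; apply: contrapT => h'; apply: h; exists B => N.
  by rewrite leNgt; apply/negP => BS; apply: h'; exists N.
pose E := [set \sum_(n < N) t n ^+ 2 | N in [set: nat]].
have supE : has_sup E.
  by split; [exists (\sum_(n < 0) t n ^+ 2), 0%N|exists B => _ [N _ <-]].
have half : 0 < 2^-1 :> R by lra.
(* The first [M] terms come within 1/2 of the supremum of the partial sums, so no later block can
   exceed 1/2. *)
have [_ [M _ <-] hM] := sup_adherent half supE.
exists M => k.
have : \sum_(n < M + k) t n ^+ 2 <= sup E.
  by apply: ub_le_sup; [exact: supE.2|exists (M + k)%N].
by rewrite big_split_ord /=; move: hM; lra.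
Qed.

Section Counterexample.
Variables (M : nat).
Local Notation V := 'rV[R]_(M + 2).
Local Notation ip := (@dot (M + 2)).
Local Notation "`[ x ]" := (hnorm ip x) (format "`[ x ]").

Lemma dot2 (v w : 'rV[R]_2) : dot v w = v 0 0 * w 0 0 + v 0 1 * w 0 1.
Proof.
rewrite /dot big_ord_recl big_ord1 (_ : lift ord0 ord0 = 1) //; exact: val_inj.
Qed.

Definition circle_dict : set V :=
  [set h | (exists i, h = row_mx (delta_mx 0 i) 0) \/
           exists2 v, dot v v = 1 & h = row_mx 0 v].

Lemma dot_circle (x : V) v : ip x (row_mx 0 v) = dot (rsubmx x) v.
Proof. by rewrite -{1}[x]hsubmxK dot_row_mx (ip0r (dot_hilbert M)) add0r. Qed.

Lemma dot_axis (x : V) i : ip x (row_mx (delta_mx 0 i) 0) = lsubmx x 0 i.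
Proof.
by rewrite -{1}[x]hsubmxK dot_row_mx (ip0r (dot_hilbert 2)) addr0 dot_delta.
Qed.

Lemma circle_dict_unit h : circle_dict h -> `[h] = 1.
Proof.
have one : ip h h = 1 -> `[h] = 1 by rewrite /hnorm => ->; rewrite sqrtr1.
move=> [[i hE]|[v v1 hE]]; apply: one.
  by rewrite {2}hE dot_axis hE row_mxKl mxE !eqxx.
by rewrite {2}hE dot_circle hE row_mxKr.
Qed.

Lemma circle_dict_delta i : circle_dict (delta_mx 0 i).
Proof.
case: (split_ordP i) => j ->; last first.
  right; exists (delta_mx 0 j); last by rewrite -delta_mx_rshift.
  by rewrite dot_delta mxE !eqxx.
by left; exists j; rewrite -delta_mx_lshift.
Qed.

Lemma circle_dict_dictionary : dictionary ip circle_dict.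
Proof.
split=> [h /circle_dict_unit//|x e e0]; exists x; split; last first.
  by rewrite subrr hnorm0 //; exact: dot_hilbert.
exists (M + 2)%N, (fun i => x 0 i), (delta_mx 0); split; last exact: row_sum_delta.
exact: circle_dict_delta.
Qed.

(** Needed because [t n = 1] may occur. On the circle the best direction is that of [rsubmx x];
    comparing it with the [M] axes is a finite maximum, indexed by [option 'I_M]. *)
Lemma circle_dict_max : wga_max_attained ip circle_dict.
Proof.
move=> x; have hip2 := dot_hilbert 2.
have [v v1 vmax] : exists2 v, dot v v = 1 &
    forall w, dot w w = 1 -> `|dot (rsubmx x) w| <= `|dot (rsubmx x) v|.
  set y := rsubmx x; have [y0|y0] := eqVneq y 0.
    exists (delta_mx 0 0); first by rewrite dot_delta mxE.
    by move=> w _; rewrite y0 !(ip0l hip2).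
  have yy : dot y y != 0 by apply: contra_neq y0; exact: (ip_eq0 hip2).
  set r := hnorm (@dot 2) y; have r2 : r ^+ 2 = dot y y by rewrite sqr_hnorm.
  have r0 : r != 0 by apply: contra_neq yy => r0; rewrite -r2 r0 expr0n.
  exists (r^-1 *: y); first by rewrite !(ipE hip2) -r2 expr2; field.
  move=> w w1; rewrite (ipZr hip2) -r2 expr2 mulKf // [leRHS]ger0_norm ?hnorm_ge0 //.
  apply: le_trans (cauchy_schwarz hip2 _ _) _.
  by rewrite [X in _ * X]/hnorm w1 sqrtr1 mulr1.
pose G (j : option 'I_M) : V :=
  if j is Some i then row_mx (delta_mx 0 i) 0 else row_mx 0 v.
have [j _ jmax] := @arg_maxP _ _ _ None xpredT (fun j => `|ip x (G j)|) isT.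
exists (G j); split.
  by case: (j) => [i|]; [left; exists i|right; exists v].
move=> _ [[i ->]|[w w1 ->]]; first exact: (jmax (Some i)).
by apply: le_trans (jmax None isT); rewrite /= !dot_circle; exact: vmax.
Qed.

Definition rot90 (v : 'rV[R]_2) : 'rV[R]_2 :=
  \row_j (if j == 0 then - v 0 1 else v 0 0).

Lemma dot_rot90 v : dot v (rot90 v) = 0.
Proof. by rewrite dot2 !mxE /=; ring. Qed.

Lemma dot_rot90_rot90 v : dot (rot90 v) (rot90 v) = dot v v.
Proof. by rewrite !dot2 !mxE /=; ring. Qed.

(* The vector of length [hnorm dot v] whose inner product with [v] is exactly
   [c * dot v v]: the least admissible choice of the weak greedy algorithm. *)
Definition tilt (c : R) (v : 'rV[R]_2) := c *: v + Num.sqrt (1 - c ^+ 2) *: rot90 v.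

Lemma dot_tilt c v : dot v (tilt c v) = c * dot v v.
Proof. by rewrite !(ipE (dot_hilbert 2)) dot_rot90 mulr0 addr0. Qed.

Lemma dot_tilt_tilt c v : 0 <= c <= 1 -> dot (tilt c v) (tilt c v) = dot v v.
Proof.
move=> /andP[c0 c1]; rewrite !(ipE (dot_hilbert 2)) dot_rot90 dot_rot90_rot90.
rewrite (ipC (dot_hilbert 2) (rot90 v)) dot_rot90 !mulr0 addr0 add0r !mulrA -expr2.
rewrite -expr2 sqr_sqrtr ?subr_ge0 ?expr_le1 //; ring.
Qed.

Variables (t : nat -> R).
Hypothesis t01 : forall n, 0 <= t n <= 1.
Hypothesis t_tail : forall k, \sum_(j < k) t (M + j)%N ^+ 2 <= 2^-1.

(** The circle part after [M + k] steps. With [c] the weakness parameter and [v] the current vector,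
    the dictionary element is [tilt c v] divided by [|v|] and its coefficient is [c * |v|], so the
    norms cancel in the subtracted term. *)
Fixpoint planar k : 'rV[R]_2 :=
  if k is j.+1 then planar j - t (M + j)%N *: tilt (t (M + j)%N) (planar j)
  else delta_mx 0 0.

Lemma planarS k :
  dot (planar k.+1) (planar k.+1) = (1 - t (M + k)%N ^+ 2) * dot (planar k) (planar k).
Proof.
have hip2 := dot_hilbert 2; rewrite /=; set c := t _; set v := planar k.
have := dot_tilt c v; have := dot_tilt_tilt v (t01 (M + k)).
move: (tilt c v) => w ww vw.
by rewrite !(ipE hip2) (ipC hip2 w v) vw ww; ring.
Qed.

Lemma planar_le1 k : dot (planar k) (planar k) <= 1.
Proof.
elim: k => [|k IH]; first by rewrite dot_delta mxE !eqxx.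
rewrite planarS; have := ip_ge0 (dot_hilbert 2) (planar k).
have := sqr_ge0 (t (M + k)%N); move: IH; nra.
Qed.

Lemma planar_ge_half k : 2^-1 <= dot (planar k) (planar k).
Proof.
(* A product of factors [1 - a_j] is at least 1 minus the sum of the [a_j]: each step loses [a_k]
   times a squared norm that is at most 1. *)
suff : 1 - \sum_(j < k) t (M + j)%N ^+ 2 <= dot (planar k) (planar k).
  by have := t_tail k; lra.
elim: k => [|k IH]; first by rewrite big_ord0 subr0 dot_delta mxE !eqxx.
rewrite planarS big_ord_recr /=; move: IH (planar_le1 k).
have := sqr_ge0 (t (M + k)%N); nra.
Qed.

(** Axis coordinate [i] is 1 until step [i] erases it. Truncated subtraction keeps the circle part
    at its initial value for [n <= M]. *)
Definition residual (n : nat) : V :=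
  row_mx (\row_(i < M) (n <= i)%:R) (planar (n - M)).

Lemma circle_dict_le (x h : V) : circle_dict h -> `|ip x h| <= `[x].
Proof.
move=> /circle_dict_unit h1.
by have := cauchy_schwarz (dot_hilbert _) x h; rewrite h1 mulr1.
Qed.

Lemma wga_bound (x g : V) c (b : R) : 0 <= c -> circle_dict g ->
  (forall h, circle_dict h -> `|ip x h| <= b) -> c * b <= `|ip x g| ->
  c * sup [set `|ip x h| | h in circle_dict] <= `|ip x g|.
Proof.
move=> c0 Dg xb; apply: le_trans; apply: ler_wpM2l => //.
by apply: ge_sup; [exists `|ip x g|, g|move=> _ [h Dh <-]; exact: xb].
Qed.

Lemma residual_wga : wga ip circle_dict t (residual 0) residual.
Proof.
split=> //; suff /choice[g hg] : forall n, exists g, circle_dict g /\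
    t n * sup [set `|ip (residual n) h| | h in circle_dict] <= `|ip (residual n) g| /\
    residual n.+1 = residual n - ip (residual n) g *: g by exists g.
move=> n; have /andP[t0 t1] := t01 n; have [nM|Mn] := ltnP n M.
  (* All inner products with the dictionary are at most 1 here, and axis [n] reaches 1, so it is
     admissible for every [t n <= 1]. *)
  pose i := Ordinal nM; pose g : V := row_mx (delta_mx 0 i) 0.
  have Dg : circle_dict g by left; exists i.
  have xg : ip (residual n) g = 1 by rewrite dot_axis row_mxKl mxE /= leqnn.
  exists g; split=> //; split.
    apply: (wga_bound (b := 1)) => //; last by rewrite xg normr1 mulr1.
    move=> h [[j ->]|[v v1 ->]].
      by rewrite dot_axis row_mxKl mxE; case: (_ <= _)%N; rewrite ?normr1 ?normr0.
    rewrite dot_circle row_mxKr.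
    have /eqP -> : (n - M == 0)%N by rewrite subn_eq0 ltnW.
    apply: le_trans (cauchy_schwarz (dot_hilbert 2) _ _) _.
    by rewrite /hnorm v1 dot_delta mxE !eqxx sqrtr1 mulr1.
  rewrite xg scale1r /residual /g opp_row_mx add_row_mx oppr0 addr0.
  have /eqP -> : (n.+1 - M == 0)%N by rewrite subn_eq0.
  have /eqP -> : (n - M == 0)%N by rewrite subn_eq0 ltnW.
  congr row_mx; apply/rowP => j; rewrite !mxE /= -val_eqE /=.
  by case: (ltngtP n j) => _; rewrite ?subr0 ?subrr.
have xE : residual n = row_mx 0 (planar (n - M)).
  congr row_mx; apply/rowP => j; rewrite !mxE leqNgt.
  by rewrite (leq_trans (ltn_ord j) Mn).
have tE : t (M + (n - M))%N = t n by rewrite subnKC.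
set v := planar (n - M) in xE; set r := hnorm (@dot 2) v.
have r2 : r ^+ 2 = dot v v by rewrite sqr_hnorm //; exact: dot_hilbert.
have r0 : 0 < r.
  rewrite lt_def hnorm_ge0 andbT; apply: contraTneq (planar_ge_half (n - M)) => r0.
  by rewrite -/v -r2 r0 expr0n /= -ltNge; lra.
have rx : `[residual n] = r by rewrite /hnorm xE dot_row_mx (ip0l (dot_hilbert M)) add0r.
have hip2 := dot_hilbert 2.
(* The supremum is at most [r], the norm of the residual, and this element attains [t n * r]. *)
pose g : V := row_mx 0 (r^-1 *: tilt (t n) v).
have Dg : circle_dict g.
  right; exists (r^-1 *: tilt (t n) v) => //.
  by rewrite (ipZl hip2) (ipZr hip2) dot_tilt_tilt // -r2; field; rewrite gt_eqF.
have xg : ip (residual n) g = t n * r.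
  rewrite dot_circle xE row_mxKr (ipZr hip2) dot_tilt -r2; field; by rewrite gt_eqF.
exists g; split=> //; split.
  apply: (wga_bound (b := r)) => // [h /circle_dict_le|]; first by rewrite -rx; exact.
  by rewrite xg ler_norm.
rewrite xg xE /residual /g subSn //= -/v tE scale_row_mx opp_row_mx add_row_mx.
rewrite scaler0 subr0 !scalerA mulfK ?gt_eqF //; congr row_mx.
apply/rowP => j; rewrite !mxE leqNgt ltnS.
by rewrite (leq_trans (ltnW (ltn_ord j)) Mn).
Qed.

(** Weak convergence to 0 would bring both circle coordinates below 1/2 in absolute value, hence the
    squared norm of the circle part below 1/4 + 1/4, against [planar_ge_half]. *)
Lemma residual_not_weakly_null : ~ partial_weak_limit ip residual 0.
Proof.
move=> [phi [_ lim]].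
have coord j : exists N, forall k, (N <= k)%N -> `|planar (phi k - M) 0 j| < 2^-1.
  have /cvg_seqP h := lim (row_mx 0 (delta_mx 0 j)).
  have [|N hN] := h 2^-1; first by lra.
  exists N => k /hN.
  by rewrite (ip0l (dot_hilbert _)) subr0 dot_circle row_mxKr dot_delta.
have [N0 h0] := coord 0; have [N1 h1] := coord 1.
have := h0 _ (leq_maxl N0 N1); have := h1 _ (leq_maxr N0 N1).
set k := maxn _ _; have := planar_ge_half (phi k - M); rewrite dot2.
move: (planar _ 0 0) (planar _ 0 1) => a b.
rewrite -!expr2 -(real_normK (num_real a)) -(real_normK (num_real b)).
have := normr_ge0 a; have := normr_ge0 b; move: `|a| `|b| => {}a {}b; nra.
Qed.

End Counterexample.

Lemma cond_iii_i (t : nat -> R) : (forall n, 0 <= t n <= 1) -> cond_iii t -> cond_i t.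
Proof.
move=> t01 tiii; apply: contrapT => /partial_sum_tail[M tM].
apply: (residual_not_weakly_null t01 tM).
apply: (tiii _ _ (dot_hilbert _) _ (circle_dict_dictionary M) _ _ _ (residual_wga t01 tM)).
by move=> _; exact: circle_dict_max.
Qed.

Theorem theorem3 (t : nat -> R) (ht : forall n : nat, 0 <= t n <= 1) :
  (cond_i t <-> cond_ii t) /\ (cond_i t <-> cond_iii t).
Proof.
have t0 n : 0 <= t n by case/andP: (ht n).
have i_ii := cond_i_ii t0; have ii_iii := @cond_ii_iii t; have iii_i := cond_iii_i ht.
by split; split; auto.
Qed.
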